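(* For every number of nodes $n \in \mathbb{N}$ and every maximum degree $k \in [n-1]$, the length (number of graphs in the sequence) of the Simple Base-$(k+1)$ Graph $\mathcal{A}_k^{\mathrm{simple}}(V)$ and the length of the Base-$(k+1)$ Graph $\mathcal{A}_k(V)$, where $V$ is a set of $n$ nodes, are both less than or equal to $2 \log_{k+1}(n) + 2$.
   Context: Notation: $[n] = \{1,\dots,n\}$; $\mathrm{mod}(a,n)$ is the remainder of $a$ divided by $n$. All sequences of graphs below live on a common node set, so a sequence of graphs is written as a sequence of (weighted, undirected) edge sets $(E^{(1)},\dots,E^{(m)})$; its length is $|(E^{(1)},\dots,E^{(m)})| = m$. If $\mathcal{S}$ is a sequence, $E(\mathcal{S}^{(j)})$ is the edge set of its $j$-th graph. Self-loops are not listed; their weights are determined by requiring the mixing matrix to be doubly stochastic. A node is isolated in $E^{(m)}$ if no edge added so far to $E^{(m)}$ is incident to it. Wherever choices are made (ordering of nodes, splitting, selection of nodes, choice of a minimal factorization), any fixed choice is allowed. **$k$-peer Hyper-hypercube Graph $\mathcal{H}_k(V)$.** Defined for $V = \{v_1,\dots,v_n\}$ when all prime factors of $n$ are at most $k+1$. Write $n = n_1 \times \cdots \times n_L$ with $L \ge 1$ minimum such that $n_l \in [k+1]$ for all $l \in [L]$ (for $n=1$: $L=1$, $n_1=1$). For $i \in [n]$ write $i-1 = \sum_{l=1}^L d_l(i) \prod_{l'<l} n_{l'}$ with digits $0 \le d_l(i) < n_l$. For each $l \in [L]$, $E^{(l)}$ consists of all edges $(v_i,v_j)$, $i \neq j$,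 such that $d_{l'}(i) = d_{l'}(j)$ for all $l' \neq l$, each with weight $1/n_l$. Then $\mathcal{H}_k(V) = (E^{(1)},\dots,E^{(L)})$. **Simple Base-$(k+1)$ Graph $\mathcal{A}_k^{\mathrm{simple}}(V)$**, $|V| = n$. Write $n$ in base $k+1$: $n = a_1(k+1)^{p_1} + \cdots + a_L(k+1)^{p_L}$ with $p_1 > \cdots > p_L \ge 0$ and $a_l \in [k]$. (i) If all prime factors of $n$ are at most $k+1$, return $\mathcal{H}_k(V)$. (ii) Otherwise, split $V$ into disjoint subsets $V_1,\dots,V_L$ with $|V_l| = a_l(k+1)^{p_l}$, and split each $V_l$ into disjoint subsets $V_{l,1},\dots,V_{l,a_l}$ with $|V_{l,a}| = (k+1)^{p_l}$. Construct all $\mathcal{H}_k(V_l)$ and $\mathcal{H}_k(V_{l,a})$, and let $m_1 = |\mathcal{H}_k(V_1)|$. Initialize $b_l = 0$ for all $l \in [L]$ and $m = 0$. While $b_1 < |\mathcal{H}_k(V_{1,1})|$: set $m \leftarrow m+1$, $E^{(m)} \leftarrow \emptyset$, and for $l = L, L-1, \dots, 1$ in this order do the first applicable case: - if $m \le m_1$: add $E(\mathcal{H}_k(V_l)^{(m')})$ to $E^{(m)}$, where $m' = \mathrm{mod}(m-1, |\mathcal{H}_k(V_l)|)+1$; - else if $m < m_1 + l$: for each $v \in V_l$, select isolated nodes $u_1 \in V_{m-m_1,1}, \dots, u_{a_{m-m_1}} \in V_{m-m_1,a_{m-m_1}}$ and add the edges $(v,u_1),\dots,(v,u_{a_{m-m_1}})$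 to $E^{(m)}$, each with weight $\frac{|V_{m-m_1}|}{a_{m-m_1}\sum_{l'=m-m_1}^{L}|V_{l'}|}$; - else if $m = m_1 + l$ and $l \ne L$: while there are two or more isolated nodes in $V_l$, let $c$ be their number, select a set $V'$ of $\min\{k+1,c\}$ isolated nodes of $V_l$, and add to $E^{(m)}$ all edges of the complete graph on $V'$ with weights $1/|V'|$; - else: set $b_l \leftarrow b_l + 1$; if $p_l \neq 0$, add $E(\mathcal{H}_k(V_{l,a})^{(m')})$ to $E^{(m)}$ for every $a \in [a_l]$, where $m' = \mathrm{mod}(b_l - 1, |\mathcal{H}_k(V_{l,a})|)+1$; if $p_l = 0$, add $E(\mathcal{H}_k(V_l)^{(m')})$ to $E^{(m)}$, where $m' = \mathrm{mod}(b_l-1,|\mathcal{H}_k(V_l)|)+1$. Return $(E^{(1)},\dots,E^{(m)})$. **Base-$(k+1)$ Graph $\mathcal{A}_k(V)$**, $|V| = n$. Write $n = p \times q$ where all prime factors of $p$ are at most $k+1$ and $q$ is coprime to each of $2,3,\dots,k+1$. Split $V$ into disjoint subsets $V_1,\dots,V_p$ with $|V_l| = q$, and construct $\mathcal{A}_k^{\mathrm{simple}}(V_l)$ for all $l \in [p]$ (all built in the same way, so of equal length). For $m = 1,\dots,|\mathcal{A}_k^{\mathrm{simple}}(V_1)|$ let $E^{(m)} = \bigcup_{l \in [p]} E(\mathcal{A}_k^{\mathrm{simple}}(V_l)^{(m)})$. Split $V$ into disjoint subsets $U_1,\dots,U_q$ with $|U_l| = p$ and $|U_l \cap V_{l'}|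 = 1$ for all $l,l'$, and construct $\mathcal{H}_k(U_l)$ for all $l \in [q]$ (built in the same way, using the same factorization of $p$). For $m = 1,\dots,|\mathcal{H}_k(U_1)|$ let $E^{(m+|\mathcal{A}_k^{\mathrm{simple}}(V_1)|)} = \bigcup_{l\in[q]} E(\mathcal{H}_k(U_l)^{(m)})$. Let $\mathcal{E}$ be the resulting sequence, of length $|\mathcal{A}_k^{\mathrm{simple}}(V_1)| + |\mathcal{H}_k(U_1)|$. If $|\mathcal{A}_k^{\mathrm{simple}}(V)| < |\mathcal{E}|$, return $\mathcal{A}_k^{\mathrm{simple}}(V)$; otherwise return $\mathcal{E}$. *)

(* Defs.v *)
From mathcomp Require Import all_boot all_order all_algebra finmap.
From mathcomp Require Import boolp reals exp.
Set Implicit Arguments.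
Unset Strict Implicit.
Unset Printing Implicit Defensive.
Import Order.TTheory GRing.Theory Num.Theory.

Local Open Scope nat_scope.

Definition logb (R : realType) (b x : R) : R := (ln x / ln b)%R.

(** A weighted undirected edge set: the edge {x, y} of weight w is the pair
    ([set x; y], w). *)
Definition wgraph (T : finType) := {fset {set T} * rat}.

Definition edges (T : finType) (r : rel T) (w : rat) : wgraph T :=
  [fset ([set x.1; x.2], w)
     | x in [set x : T * T | (x.1 != x.2) && r x.1 x.2]]%fset.

Definition complete (T : finType) (A : {set T}) : wgraph T :=
  edges [rel x y | (x \in A) && (y \in A)] (#|A|%:R^-1)%R.

Definition isolated (T : finType) (E : wgraph T) (A : {set T}) : {set T} :=
  [set x in A | [forall e : E, x \notin (fsval e).1]].

Definition smooth (k n : nat) : bool := all (fun r => r <= k.+1) (primes n).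

Definition factorization (k n : nat) (s : seq nat) : bool :=
  [&& 0 < size s, all (fun d => 1 <= d <= k.+1) s & n == \prod_(d <- s) d].

Definition minimal_factorization (k n : nat) (s : seq nat) : Prop :=
  factorization k n s /\
  forall s', factorization k n s' -> size s <= size s'.

(** [ts] lists the pairs (a_l, p_l), l = 1, ..., L. *)
Definition base_expansion (k n : nat) (ts : seq (nat * nat)) : Prop :=
  [/\ n = \sum_(t <- ts) t.1 * k.+1 ^ t.2,
      sorted (fun t t' => t'.2 < t.2) ts
    & all (fun t => 1 <= t.1 <= k) ts].

Definition smooth_coprime (k n : nat) (pq : nat * nat) : Prop :=
  [/\ n = pq.1 * pq.2, smooth k pq.1
    & forall d, 2 <= d <= k.+1 -> coprime pq.2 d].

Definition splitting (T : finType) (A : {set T}) (s : seq nat)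
    (B : seq {set T}) : Prop :=
  [/\ [seq #|X| | X : {set T} <- B] = s,
      pairwise (fun X Y : {set T} => [disjoint X & Y]) B
    & \bigcup_(X <- B) X = A]%SET.

(** Everything the constructions below leave open.  On their domains [base_terms]
    and [smooth_part] are determined by their specifications.  [select X c]
    picks c nodes of X; since within one run of the main loop a set X of
    candidates is never offered twice, making the selection a function of X
    excludes no run. *)
Record choices (T : finType) := Choices {
  node_order : {set T} -> seq T;
  node_orderP : forall A, perm_eq (node_order A) (enum A);
  factors : nat -> nat -> seq nat;
  factorsP : forall k n, 0 < n -> smooth k n ->
    minimal_factorization k n (factors k n);
  base_terms : nat -> nat -> seq (nat * nat);
  base_termsP : forall k n, 0 < k -> 0 < n ->
    base_expansion k n (base_terms k n);
  smooth_part : nat -> nat -> nat * nat;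
  smooth_partP : forall k n, 0 < n -> smooth_coprime k n (smooth_part k n);
  split_into : {set T} -> seq nat -> seq {set T};
  split_intoP : forall (A : {set T}) s, sumn s = #|A| ->
    splitting A s (split_into A s);
  transversals : seq {set T} -> seq {set T};
  transversalsP : forall (A : {set T}) p q B, 0 < p -> 0 < q ->
    splitting A (nseq p q) B ->
    splitting A (nseq q p) (transversals B) /\
    {in transversals B & B, forall X Y, #|X :&: Y| = 1}%SET;
  select : {set T} -> nat -> {set T};
  selectP : forall (X : {set T}) c, c <= #|X| ->
    (select X c \subset X) && (#|select X c| == c)
}.

Lemma minimal_factorization_exists (k n : nat) :
  0 < n -> smooth k n -> exists s, minimal_factorization k n s.
Proof.
move=> n0 nk; have [s0 fs0] : exists s, factorization k n s.
  elim/ltn_ind: n n0 nk => n IH n0 nk; have [n1|n1] := leqP n 1.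
    exists [:: 1]; rewrite /factorization /= big_seq1.
    by apply/eqP/anti_leq; rewrite n0 n1.
  have pn := pdiv_prime n1; have dn := pdiv_dvd n.
  have m0 : 0 < n %/ pdiv n by rewrite divn_gt0 ?prime_gt0// dvdn_leq.
  have mn : n %/ pdiv n < n by rewrite ltn_Pdiv// prime_gt1.
  have [|s /and3P[ss sk /eqP sn]] := IH _ mn m0.
    apply/allP => r; rewrite mem_primes => /and3P[pr _ rd].
    apply: (allP nk); rewrite mem_primes pr n0 /=.
    exact: dvdn_trans rd (dvdn_div dn).
  exists (pdiv n :: s); rewrite /factorization /= sk big_cons -sn mulnC.
  rewrite divnK// eqxx !andbT prime_gt0//=.
  by apply: (allP nk); rewrite mem_primes pn n0.
have ex : exists m, `[< exists2 s, factorization k n s & size s = m >].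
  by exists (size s0); apply/asboolP; exists s0.
case: (ex_minnP ex) => m /asboolP[s fs <-] mins; exists s; split=> // s' fs'.
by apply: mins; apply/asboolP; exists s'.
Qed.

Lemma base_expansion_exists (k n : nat) :
  0 < k -> exists ts, base_expansion k n ts.
Proof.
move=> k0; elim/ltn_ind: n => n IH; have [->|n0] := posnP n.
  by exists [::]; split; rewrite ?big_nil.
set p := trunc_log k.+1 n; set P := k.+1 ^ p.
have P0 : 0 < P by rewrite expn_gt0.
have /andP[Pn nP] : P <= n < k.+1 ^ p.+1 by apply: trunc_log_bounds.
have rn : n %% P < n by apply: leq_trans Pn; rewrite ltn_mod.
have [ts [tn ts_sorted tk]] := IH _ rn.
exists ((n %/ P, p) :: ts); split.
- by rewrite big_cons -tn /= -divn_eq.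
- case: ts tn ts_sorted tk => //= t ts tn -> /andP[/andP[t0 _] _].
  rewrite andbT -(ltn_exp2l _ _ (m := k.+1))//.
  have : n %% P < P by rewrite ltn_mod.
  apply: leq_ltn_trans; rewrite tn big_cons.
  exact: leq_trans (leq_pmull _ t0) (leq_addr _ _).
- by rewrite /= tk divn_gt0// Pn -ltnS ltn_divLR// -expnS nP.
Qed.

Lemma smooth_coprime_exists (k n : nat) :
  0 < n -> exists pq, smooth_coprime k n pq.
Proof.
move=> n0; pose pi : nat_pred := [pred r | r <= k.+1].
exists (n`_pi, n`_pi^'); split=> /=; first by rewrite partnC.
  apply/allP => r; rewrite primes_part mem_filter => /andP[]; exact.
move=> d /andP[d2 dk]; rewrite coprime_sym (@pnat_coprime pi)//; last first.
  exact: part_pnat.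
apply/pnatP => [|r pr rd]; first by rewrite (ltn_trans _ d2).
by rewrite inE (leq_trans _ dk)// dvdn_leq// (ltn_trans _ d2).
Qed.

Lemma subset_of_card (T : finType) (X : {set T}) (c : nat) :
  c <= #|X| -> exists Y : {set T}, (Y \subset X) && (#|Y| == c).
Proof.
move=> cX; exists [set x in take c (enum X)]; apply/andP; split.
  by apply/fintype.subsetP => x; rewrite inE => /mem_take; rewrite mem_enum.
rewrite cardsE (card_uniqP _) ?take_uniq ?enum_uniq//.
by rewrite size_takel// -cardE.
Qed.

Lemma splitting_exists (T : finType) (A : {set T}) (s : seq nat) :
  sumn s = #|A| -> exists B, splitting A s B.
Proof.
elim: s A => [|c s IH] A /=.
  move=> /esym/eqP; rewrite cards_eq0 => /eqP ->.
  by exists [::]; split; rewrite ?big_nil.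
move=> sA; have [|Y /andP[YA /eqP Yc]] := @subset_of_card _ A c.
  by rewrite -sA leq_addr.
have [|B [Bs Bd BU]] := IH (A :\: Y).
  by rewrite cardsD (setIidPr YA) -sA Yc addKn.
exists (Y :: B); split=> /=; first by rewrite Bs Yc.
  rewrite Bd andbT; apply/allP => X XB; rewrite disjoint_sym.
  have : X \subset A :\: Y by rewrite -BU (big_rem X XB) /= subsetUl.
  by rewrite subsetD => /andP[].
by rewrite big_cons BU setDE setUIr finset.setUCr finset.setIT; apply/setUidPr.
Qed.

Lemma mem_bigcup (T : finType) (B : seq {set T}) (x : T) :
  (x \in \bigcup_(X <- B) X)%SET = has (fun X : {set T} => x \in X) B.
Proof. by elim: B => [|X B IH] /=; rewrite ?big_nil ?big_cons !inE ?IH. Qed.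

Lemma transversals_exist (T : finType) (A : {set T}) p q B :
  0 < p -> 0 < q -> splitting A (nseq p q) B ->
  exists U, splitting A (nseq q p) U /\
    {in U & B, forall X Y : {set T}, #|X :&: Y| = 1}%SET.
Proof.
move=> p0 q0 [Bs Bd BU].
have sB : size B = p by rewrite -(size_nseq p q) -Bs size_map.
have cB X : X \in B -> #|X| = q.
  move=> XB; have : #|X| \in [seq #|Y : {set T}| | Y <- B] by apply: map_f.
  by rewrite Bs mem_nseq => /andP[_ /eqP].
have [x0 _] : exists x0 : T, x0 \in nth set0 B 0.
  by apply/card_gt0P; rewrite cB// mem_nth// sB.
pose f (i : nat) (X : {set T}) := nth x0 (enum X) i.
have fX i X : i < q -> X \in B -> f i X \in X.
  by move=> iq XB; rewrite -mem_enum mem_nth// -cardE cB.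
have same X Y x : X \in B -> Y \in B -> x \in X -> x \in Y -> X = Y.
  move=> XB YB xX xY.
  rewrite -(nth_index set0 XB) -(nth_index set0 YB); congr nth.
  have [ij|ij|//] := ltngtP (index X B) (index Y B).
    have := pairwiseP set0 Bd (index X B) (index Y B).
    rewrite !inE !index_mem !nth_index// => /(_ XB YB ij).
    by rewrite disjoint_subset => /fintype.subsetP/(_ _ xX); rewrite inE xY.
  have := pairwiseP set0 Bd (index Y B) (index X B).
  rewrite !inE !index_mem !nth_index// => /(_ YB XB ij).
  by rewrite disjoint_subset => /fintype.subsetP/(_ _ xY); rewrite inE xX.
have uB : uniq B.
  apply/(uniqP set0) => i j; rewrite !inE => iB jB eij.
  have [ij|ij|//] := ltngtP i j.
    have := pairwiseP set0 Bd _ _ iB jB ij; rewrite eij.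
    by rewrite -setI_eq0 finset.setIid -cards_eq0 cB ?mem_nth// (gtn_eqF q0).
  have := pairwiseP set0 Bd _ _ jB iB ij; rewrite eij.
  by rewrite -setI_eq0 finset.setIid -cards_eq0 cB ?mem_nth// (gtn_eqF q0).
pose U i : {set T} := [set x in [seq f i X | X <- B]].
have cU i : i < q -> #|U i| = p.
  move=> iq; rewrite cardsE (card_uniqP _) ?size_map//.
  rewrite map_inj_in_uniq// => X Y XB YB fXY.
  by apply: (same X Y (f i X)) => //; rewrite ?fX// fXY fX.
exists [seq U i | i <- iota 0 q]; split; last first.
  move=> _ Y /mapP[i + ->] YB; rewrite mem_iota /= => iq.
  apply/eqP/cards1P; exists (f i Y); apply/setP => x; rewrite !inE.
  apply/andP/eqP => [[/mapP[X XB ->] fY]|->]; last by rewrite map_f// fX.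
  by rewrite (same X Y (f i X))// fX.
split.
- apply: (@eq_from_nth _ 0); rewrite !size_map ?size_iota ?size_nseq// => i iq.
  rewrite nth_nseq iq (nth_map set0) ?size_map ?size_iota//.
  by rewrite (nth_map 0) ?size_iota// nth_iota// cU.
- rewrite pairwise_map; apply/(pairwiseP 0) => i j.
  rewrite !inE size_iota => iq jq ij; rewrite /= !nth_iota//= !add0n.
  rewrite -setI_eq0; apply/eqP/setP => x; rewrite !inE.
  apply/negP => /andP[/mapP[X XB ->] /mapP[Y YB e]].
  have XY : X = Y by apply: (same X Y (f i X)); rewrite ?fX// e fX.
  move: e; rewrite XY => /eqP; rewrite nth_uniq ?enum_uniq -?cardE ?cB//.
  by rewrite ltn_eqF.
- apply/setP => x; rewrite -BU !mem_bigcup; apply/hasP/hasP => -[X].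
    case/mapP=> i; rewrite mem_iota /= => iq ->.
    by rewrite inE => /mapP[Y YB ->]; exists Y => //; rewrite fX.
  move=> XB xX; have iq : index x (enum X) < q.
    by rewrite -(cB _ XB) cardE index_mem mem_enum.
  exists (U (index x (enum X))); first by rewrite map_f// mem_iota.
  rewrite inE; apply/mapP; exists X => //.
  by rewrite /f nth_index// mem_enum.
Qed.

Lemma choices_inhabited (T : finType) : inhabited (choices T).
Proof.
have hf (kn : nat * nat) : exists s, 0 < kn.2 -> smooth kn.1 kn.2 ->
    minimal_factorization kn.1 kn.2 s.
  have [n0|n0] := boolP (0 < kn.2); last by exists [::].
  have [nk|nk] := boolP (smooth kn.1 kn.2); last by exists [::].
  by have [s sP] := minimal_factorization_exists n0 nk; exists s.
have ht (kn : nat * nat) : exists s, 0 < kn.1 -> base_expansion kn.1 kn.2 s.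
  have [k0|k0] := boolP (0 < kn.1); last by exists [::].
  by have [s sP] := base_expansion_exists kn.2 k0; exists s.
have hp (kn : nat * nat) : exists s, 0 < kn.2 -> smooth_coprime kn.1 kn.2 s.
  have [n0|n0] := boolP (0 < kn.2); last by exists (0, 0).
  by have [s sP] := smooth_coprime_exists kn.1 n0; exists s.
have hs (As : {set T} * seq nat) : exists B, sumn As.2 = #|As.1| ->
    splitting As.1 As.2 B.
  have [e|e] := eqVneq (sumn As.2) #|As.1|; last first.
    by exists [::] => /eqP; rewrite (negPf e).
  by have [B BP] := splitting_exists e; exists B.
have hr (B : seq {set T}) : exists U, forall (A : {set T}) p q, 0 < p -> 0 < q ->
    splitting A (nseq p q) B -> splitting A (nseq q p) U /\
    {in U & B, forall X Y : {set T}, #|X :&: Y| = 1}%SET.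
  have [[A [p [q [p0 q0 ABpq]]]]|no] := pselect (exists (A : {set T}) p q,
      [/\ 0 < p, 0 < q & splitting A (nseq p q) B]); last first.
    by exists [::] => A p q p0 q0 h; case: no; exists A, p, q.
  have [U UP] := transversals_exist p0 q0 ABpq; exists U => A' p' q' p'0 q'0 h.
  have -> : A' = A by case: ABpq h => _ _ <- [].
  have e : nseq p' q' = nseq p q by case: ABpq h => <- _ _ [].
  have -> : p' = p by rewrite -(size_nseq p' q') e size_nseq.
  have -> // : q' = q.
  by case: p' q' {h} e p'0 q'0 => // p' q'; case: p p0 {ABpq UP} => // p _ [].
have hc (Xc : {set T} * nat) : exists Y : {set T}, Xc.2 <= #|Xc.1| ->
    (Y \subset Xc.1) && (#|Y| == Xc.2).
  have [cX|cX] := boolP (Xc.2 <= #|Xc.1|); last by exists set0.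
  by have [Y YP] := subset_of_card cX; exists Y.
have [[fs fsP] [ts tsP]] := (choice hf, choice ht).
have [[pq pqP] [sp spP]] := (choice hp, choice hs).
have [[tr trP] [se seP]] := (choice hr, choice hc).
by split; exact: (@Choices T (fun A => enum A) (fun A => perm_refl _)
  (fun k n => fs (k, n)) (fun k n => fsP (k, n))
  (fun k n => ts (k, n)) (fun k n k0 _ => tsP (k, n) k0)
  (fun k n => pq (k, n)) (fun k n => pqP (k, n))
  (fun A s => sp (A, s)) (fun A s => spP (A, s))
  tr (fun A p q B => trP B A p q)
  (fun X c => se (X, c)) (fun X c => seP (X, c))).
Qed.

(** Digits of i, counted from 0, in the mixed radix s = (n_1, ..., n_L). *)
Definition digit (s : seq nat) (l i : nat) : nat :=
  (i %/ \prod_(d <- take l s) d) %% nth 1 s l.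

Lemma digitE (s : seq nat) (i : nat) :
  all (leq 1) s -> i < \prod_(d <- s) d ->
  i = \sum_(l < size s) digit s l i * \prod_(d <- take l s) d.
Proof.
elim: s i => [|n s IH] i /=; first by rewrite big_nil big_ord0 ltnS leqn0 => _ /eqP.
case/andP=> n0 s0; rewrite big_cons => ilt.
rewrite big_ord_recl /= /digit /= big_nil divn1 muln1.
have := IH (i %/ n) s0; rewrite ltn_divLR// mulnC => /(_ ilt) IHi.
rewrite {1}(divn_eq i n) addnC {1}IHi big_distrl /=; congr (_ + _).
apply: eq_bigr => l _; rewrite big_cons /digit divnMA -!mulnA.
by congr (_ * _); rewrite mulnC.
Qed.

Definition hypercube_layer (T : finType) (v : seq T) (s : seq nat) (l : nat) :
    wgraph T :=
  edges [rel x y | [&& x \in v, y \in v &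
           all (fun l' => (l' == l) ||
                  (digit s l' (index x v) == digit s l' (index y v)))
               (iota 0 (size s))]]
        ((nth 1 s l)%:R^-1)%R.

Definition hyper_hypercube (T : finType) (C : choices T) (k : nat)
    (V : {set T}) : seq (wgraph T) :=
  let s := factors C k #|V| in
  [seq hypercube_layer (node_order C V) s l | l <- iota 0 (size s)].

(** The graph of index mod(t - 1, |S|) + 1 of the sequence S. *)
Definition cyclic_nth (T : finType) (S : seq (wgraph T)) (t : nat) : wgraph T :=
  nth fset0 S ((t - 1) %% size S).

(** In the following definitions l and m are counted from 1. *)
Section SimpleBase.
Context (T : finType) (C : choices T) (k : nat) (V : {set T}).

Local Notation H := (hyper_hypercube C k).

Definition terms : seq (nat * nat) := base_terms C k #|V|.
Definition nterms : nat := size terms.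
Definition coef (l : nat) : nat := (nth (0, 0) terms l.-1).1.
Definition expo (l : nat) : nat := (nth (0, 0) terms l.-1).2.

Definition part (l : nat) : {set T} :=
  nth set0 (split_into C V [seq t.1 * k.+1 ^ t.2 | t <- terms]) l.-1.
Definition subparts (l : nat) : seq {set T} :=
  split_into C (part l) (nseq (coef l) (k.+1 ^ expo l)).
Definition subpart (l a : nat) : {set T} := nth set0 (subparts l) a.-1.

Definition len1 : nat := size (H (part 1)).

Definition link_weight (j : nat) : rat :=
  (#|part j|%:R /
   ((coef j)%:R * (\sum_(j <= l' < nterms.+1) #|part l'|)%:R))%R.

Definition link_node (j : nat) (E : wgraph T) (v : T) : wgraph T :=
  foldl (fun E' a =>
           E' `|` edges [rel x y | (x == v) &&
                          (y \in select C (isolated E' (subpart j a)) 1)]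
                        (link_weight j))%fset
        E (iota 1 (coef j)).

Definition link (j l : nat) (E : wgraph T) : wgraph T :=
  foldl (link_node j) E (node_order C (part l)).

Definition add_clique (l : nat) (E : wgraph T) : wgraph T :=
  let X := isolated E (part l) in
  if 2 <= #|X| then (E `|` complete (select C X (minn k.+1 #|X|)))%fset else E.

(** Each effective [add_clique] decreases the number of isolated nodes, so that
    #|part l| attempts exhaust the loop. *)
Definition cliques (l : nat) (E : wgraph T) : wgraph T :=
  iter #|part l| (add_clique l) E.

Definition level (m : nat) (Eb : wgraph T * (nat -> nat)) (l : nat) :
    wgraph T * (nat -> nat) :=
  let: (E, b) := Eb in
  if m <= len1 then ((E `|` cyclic_nth (H (part l)) m)%fset, b)
  else if m < len1 + l then (link (m - len1) l E, b)
  else if (m == len1 + l) && (l != nterms) then (cliques l E, b)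
  else
    let t := b l + 1 in
    ((E `|` if expo l != 0
            then \bigcup_(A <- subparts l) cyclic_nth (H A) t
            else cyclic_nth (H (part l)) t)%fset,
     fun l' => if l' == l then t else b l').

(** State of the main loop: the graphs E^(1), ..., E^(m) and the counters b. *)
Definition state := (seq (wgraph T) * (nat -> nat))%type.

Definition initial : state := ([::], fun=> 0).

Definition next_state (st : state) : state :=
  let: (E, b) := foldl (level (size st.1).+1) (fset0, st.2)
                       (rev (iota 1 nterms)) in
  (rcons st.1 E, b).

(** [0 < nterms] always holds for nonempty V and positive k; it makes the loop
    terminate in the degenerate cases as well. *)
Definition continues (st : state) : bool :=
  (0 < nterms) && (st.2 1 < size (H (subpart 1 1))).

Lemma loop_stops : exists m, ~~ continues (iter m next_state initial).
Proof.
rewrite /continues; have [_|L0] := posnP nterms; first by exists 0.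
have szE m : size (iter m next_state initial).1 = m.
  elim: m => //= m IH; rewrite /next_state; case: foldl => E b /=.
  by rewrite size_rcons IH.
have keep m ls st : 1 \notin ls -> (foldl (level m) st ls).2 1 = st.2 1.
  elim: ls st => //= l ls IH st; rewrite inE negb_or => /andP[l1 ls1].
  rewrite IH// /level; case: st => E b /=.
  by do 3?[case: ifP => // _] => /=; rewrite (negPf l1).
have up m st : len1.+1 < m ->
    (foldl (level m) st (rev (iota 1 nterms))).2 1 = st.2 1 + 1.
  move=> lm; rewrite -{1}(prednK L0) /= rev_cons foldl_rcons.
  rewrite -(keep m (rev (iota 2 nterms.-1)) st); last by rewrite mem_rev mem_iota.
  case: (foldl _ _ _) => E b; rewrite /level /=.
  rewrite leqNgt (ltn_trans (ltnSn _) lm) /= addn1 ltnNge (ltnW lm) /=.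
  by rewrite (gtn_eqF lm).
have lower t : t <= (iter (len1.+1 + t) next_state initial).2 1.
  elim: t => // t IH; rewrite addnS iterS /next_state.
  have := up (size (iter (len1.+1 + t) next_state initial).1).+1
    (fset0, (iter (len1.+1 + t) next_state initial).2).
  rewrite szE; case: foldl => E b /= ->; last by rewrite ltnS leq_addr.
  by rewrite addn1 ltnS.
by exists (len1.+1 + size (H (subpart 1 1))); rewrite /= -leqNgt lower.
Qed.

Definition simple_base_graph : seq (wgraph T) :=
  if smooth k #|V| then H V
  else (iter (ex_minn loop_stops) next_state initial).1.

End SimpleBase.

Section Base.
Context (T : finType) (C : choices T) (k : nat) (V : {set T}).

Definition superpose (F : {set T} -> seq (wgraph T)) (Vs : seq {set T}) :
    seq (wgraph T) :=
  [seq (\bigcup_(X <- Vs) nth fset0 (F X) m)%fset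
     | m <- iota 0 (size (F (nth set0 Vs 0)))].

Definition product_sequence : seq (wgraph T) :=
  let: (p, q) := smooth_part C k #|V| in
  let Vs := split_into C V (nseq p q) in
  superpose (simple_base_graph C k) Vs ++
  superpose (hyper_hypercube C k) (transversals C Vs).

Definition base_graph : seq (wgraph T) :=
  if size (simple_base_graph C k V) < size product_sequence
  then simple_base_graph C k V else product_sequence.

End Base.

(* Main.v *)
(** For a smooth n the sequence has one graph per factor. In a shortest
    factorization two consecutive factors have product larger than k + 1, since
    they could be merged otherwise; hence L factors give (k+1)^(L/2) <= n.
    For the other n, the counter b_1 is increased in every round m > m_1 + 1, so
    that the loop stops after at most m_1 + 1 + |H_k(V_{1,1})| rounds. With p_1
    the leading exponent of n in base k + 1, the factorizations of
    |V_1| = a_1 (k+1)^p_1 and |V_{1,1}| = (k+1)^p_1 into digits and powers of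
    k + 1 bound this by 2 p_1 + 2, where (k+1)^p_1 <= n. *)
Require Import Defs.
From mathcomp Require Import all_boot all_order all_algebra reals.
From mathcomp Require Import finmap exp.
Set Implicit Arguments.
Unset Strict Implicit.
Unset Printing Implicit Defensive.
Import Order.TTheory GRing.Theory Num.Theory.
Local Open Scope nat_scope.

Lemma factorization_gt0 k n s : factorization k n s -> 0 < n.
Proof.
case/and3P=> _ /allP sk /eqP ->; rewrite big_seq prodn_cond_gt0// => d /sk.
by case/andP.
Qed.

Lemma factorization_smooth k n s : factorization k n s -> smooth k n.
Proof.
case/and3P=> _ /allP sk /eqP ->; apply/allP => r.
rewrite mem_primes => /and3P[pr _]; rewrite big_seq.
elim/big_rec: _ => [|d m /sk/andP[d0 dk] IH].
  by rewrite dvdn1 => /eqP r1; rewrite r1 in pr.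
by rewrite Euclid_dvdM// => /orP[/dvdn_leq/(leq_trans)->|].
Qed.

Lemma minimal_factorization_sorted k n s :
  minimal_factorization k n s -> sorted (fun x y => k.+1 < x * y) s.
Proof.
case=> /and3P[_ sk /eqP ns] mins; apply/(sortedP 1) => i isz.
rewrite ltnNge; apply/negP => xyk.
have es : s = take i s ++ [:: nth 1 s i, nth 1 s i.+1 & drop i.+2 s].
  by rewrite -drop_nth// -drop_nth ?cat_take_drop// ltnW.
set x := nth 1 s i in xyk es *; set y := nth 1 s i.+1 in xyk es *.
set u := take i s in es; set w := drop i.+2 s in es.
move: sk; rewrite es all_cat /= => /and4P[uk /andP[x0 _] /andP[y0 _] wk].
have /mins : factorization k n (u ++ x * y :: w).
  rewrite /factorization size_cat /= addnS /= all_cat /= uk wk muln_gt0 x0 y0.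
  by rewrite xyk ns es !big_cat !big_cons /= -mulnA eqxx.
by rewrite es !size_cat /= !addnS ltnn.
Qed.

(** Factors are paired off from the front, each pair contributing more than [k.+1]; the factor left
    over when the length is odd is only known to be at least 1. *)
Lemma expn_half_size_le_prod k s :
  all (leq 1) s -> sorted (fun x y => k.+1 < x * y) s ->
  k.+1 ^ (size s)./2 <= \prod_(d <- s) d.
Proof.
have [m sm] := ubnP (size s); elim: m s sm => // m IH [|x [|y s]] //= sm.
- by rewrite big_nil.
- by rewrite big_seq1 andbT.
case/and3P=> _ _ s0 /andP[xy ys]; rewrite !big_cons mulnA expnS leq_mul//.
  exact: ltnW.
by apply: IH => //; [rewrite ltnS in sm; exact: ltnW|exact: path_sorted ys].
Qed.

Lemma minimal_factorization_size k n s :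
  minimal_factorization k n s -> k.+1 ^ (size s)./2 <= n.
Proof.
move=> ms; have [/and3P[_ sk /eqP ->] _] := ms.
apply: expn_half_size_le_prod (minimal_factorization_sorted ms).
by apply: sub_all sk => d /andP[].
Qed.

(** Turns any explicit factorization into a length bound: the chosen one is shortest, and the
    existence of [s] already forces positivity and smoothness. *)
Lemma size_hyper_hypercube_le (T : finType) (C : choices T) k (V : {set T}) s :
  factorization k #|V| s -> size (hyper_hypercube C k V) <= size s.
Proof.
move=> fs; rewrite size_map size_iota.
have [_] := factorsP C (factorization_gt0 fs) (factorization_smooth fs).
exact.
Qed.

Lemma smooth_size_hyper_hypercube (T : finType) (C : choices T) k (V : {set T}) :
  0 < #|V| -> smooth k #|V| -> k.+1 ^ (size (hyper_hypercube C k V))./2 <= #|V|.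
Proof.
move=> V0 kV; rewrite size_map size_iota.
exact: minimal_factorization_size (factorsP C V0 kV).
Qed.

(** Serves both leading sets: [e] will be the leading digit for [part 1], and [k.+1] itself for
    [subpart 1 1]. *)
Lemma factorization_nseq k e p : 0 < e <= k.+1 ->
  factorization k (e * k.+1 ^ p) (e :: nseq p k.+1).
Proof.
move=> ek; rewrite /factorization /= ek all_nseq leqnn orbT /=.
by rewrite big_cons big_nseq iter_muln_1.
Qed.

Lemma card_nth_splitting (T : finType) (A : {set T}) s B i :
  splitting A s B -> i < size s -> #|nth set0 B i| = nth 0 s i.
Proof. by case=> <- _ _; rewrite size_map => iB; rewrite (nth_map set0). Qed.

Section SimpleBaseLength.
Context (T : finType) (C : choices T) (k : nat) (V : {set T}).

Lemma size_iter_next_state m :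
  size (iter m (next_state C k V) (initial T)).1 = m.
Proof.
elim: m => //= m; rewrite {2}/next_state; case: foldl => E b /=.
by rewrite size_rcons => ->.
Qed.

Lemma foldl_level_counter m ls Eb l : l \notin ls ->
  (foldl (level C k V m) Eb ls).2 l = Eb.2 l.
Proof.
elim: ls Eb => //= l' ls IH [E b]; rewrite inE negb_or => /andP[ll' lls].
rewrite IH// /level.
by do 3?[case: ifP => // _] => /=; rewrite (negPf ll').
Qed.

Lemma next_state_counter1 st : 0 < nterms C k V ->
  len1 C k V < size st.1 -> (next_state C k V st).2 1 = (st.2 1).+1.
Proof.
move=> L0 lst; rewrite /next_state.
(* Levels are processed in decreasing order, so level 1 comes last; the levels before it do not
   touch counter 1. *)
rewrite -(prednK L0) /= rev_cons foldl_rcons.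
have := @foldl_level_counter (size st.1).+1 (rev (iota 2 (nterms C k V).-1))
  (fset0, st.2) 1.
rewrite mem_rev mem_iota => /(_ isT); case: foldl => E b /= <-.
(* The round number is at least [len1 + 2], so at level 1 the first three cases of [level] fail and
   the counter advances. *)
rewrite /level addn1 leqNgt ltnS (ltnW lst) /= ltnS ltnNge (ltnW lst) /= eqSS.
by rewrite (gtn_eqF lst) /= addn1.
Qed.

(** Nothing is claimed about the first [len1 + 1] rounds; each later one raises counter 1 by one. *)
Lemma iter_next_state_counter1 t : 0 < nterms C k V ->
  t <= (iter (t + (len1 C k V).+1) (next_state C k V) (initial T)).2 1.
Proof.
move=> L0; elim: t => // t IH.
rewrite addSn iterS next_state_counter1// size_iter_next_state addnS ltnS.
exact: leq_addl.
Qed.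

Lemma size_simple_base_graph_le : ~~ smooth k #|V| ->
  size (simple_base_graph C k V) <=
  size (hyper_hypercube C k (subpart C k V 1 1)) +
  (size (hyper_hypercube C k (part C k V 1))).+1.
Proof.
move=> nsV; rewrite /simple_base_graph (negPf nsV) size_iter_next_state.
(* The loop ends at the least index where [continues] fails, so exhibiting one such index
   suffices. *)
case: ex_minnP => m _; apply; rewrite /continues.
by have [//|L0] := posnP; rewrite -leqNgt iter_next_state_counter1.
Qed.

Lemma leading_term : 0 < k < #|V| ->
  exists a p ts, [/\ terms C k V = (a, p) :: ts, 0 < a <= k, 0 < p
    & k.+1 ^ p <= #|V|].
Proof.
case/andP=> k0 kV; have V0 := ltn_trans k0 kV.
have [] := base_termsP C k0 V0; rewrite -/(terms C k V).
case: terms => [|[a p] ts]; first by rewrite big_nil => V0'; rewrite V0' in V0.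
rewrite big_cons /= => eV sts /andP[ak _]; exists a, p, ts; split=> //; last first.
  rewrite eV (leq_trans _ (leq_addr _ _))// leq_pmull//.
  by case/andP: ak.
(* Exponents decrease strictly, so a leading exponent 0 would leave [a] as the only term, giving
   [#|V| = a <= k]. *)
have [p0|//] := posnP p; move: kV eV sts; rewrite p0 muln1.
case: ts => [|//] + eV; rewrite eV big_nil addn0 ltnNge.
by case/andP: ak => _ ->.
Qed.

Lemma size_simple_base_graph : 0 < k < #|V| ->
  exists2 p, size (simple_base_graph C k V) <= p.*2.+2 & k.+1 ^ p <= #|V|.
Proof.
move=> kV; have /andP[k0 k_lt] := kV; have V0 := ltn_trans k0 k_lt.
have [sV|nsV] := boolP (smooth k #|V|).
  (* Halving rounds down and loses at most 1, well within the slack of 2. *)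
  exists (size (hyper_hypercube C k V))./2.
    rewrite /simple_base_graph sV -[leqLHS]odd_double_half -addn2 addnC.
    by rewrite leq_add2l; case: odd.
  exact: smooth_size_hyper_hypercube.
have [a [p [ts [ets /andP[a0 ak] p0 pV]]]] := leading_term kV.
exists p => //; apply: leq_trans (size_simple_base_graph_le nsV) _.
have [eV _ _] := base_termsP C k0 V0.
have card_part : #|part C k V 1| = a * k.+1 ^ p.
  rewrite /part (card_nth_splitting (split_intoP C _)) ?ets//.
  by rewrite -ets sumnE big_map -eV.
have card_subpart : #|subpart C k V 1 1| = k.+1 ^ p.
  rewrite /subpart /subparts (card_nth_splitting (split_intoP C _)).
  - by rewrite nth_nseq /coef ets /= a0 /expo ets.
  - by rewrite sumn_nseq card_part /coef /expo ets /= mulnC.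
  - by rewrite size_nseq /coef ets.
have : size (hyper_hypercube C k (subpart C k V 1 1)) <= p.
  (* A factorization has at least one factor, so [p] factors require [0 < p]; one copy of [k.+1]
     becomes the head. *)
  have -> : p = size (k.+1 :: nseq p.-1 k.+1) by rewrite /= size_nseq prednK.
  apply: size_hyper_hypercube_le.
  by rewrite card_subpart -[in k.+1 ^ p](prednK p0) expnS factorization_nseq ?leqnn.
have : size (hyper_hypercube C k (part C k V 1)) <= p.+1.
  have -> : p.+1 = size (a :: nseq p k.+1) by rewrite /= size_nseq.
  apply: size_hyper_hypercube_le.
  by rewrite card_part factorization_nseq// a0 leqW.
move=> h1 h2; rewrite -addnn -addnS -addnS; exact: leq_add.
Qed.

(** The product sequence is returned only when it is no longer than the simple one, so it inherits
    the bound. *)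
Lemma size_base_graph_le :
  size (base_graph C k V) <= size (simple_base_graph C k V).
Proof. by rewrite /base_graph; case: ltnP. Qed.

End SimpleBaseLength.

Lemma natr_le_logb (R : realType) (b n p : nat) : 1 < b -> b ^ p <= n ->
  (p%:R <= logb b%:R n%:R :> R)%R.
Proof.
move=> b1 bpn; have b0 : (0 < b%:R :> R)%R by rewrite ltr0n ltnW.
rewrite /logb ler_pdivlMr ?ln_gt0 ?ltr1n// mulr_natl -lnXn// -natrX.
by rewrite ler_ln ?ler_nat// posrE ltr0n ?(leq_trans _ bpn)// expn_gt0 (ltnW b1).
Qed.

Theorem theorem1 (R : realType) (n k : nat) (hk : (1 <= k <= n - 1)%N)
    (T : finType) (V : {set T}) (hV : #|V| = n) (C : choices T) :
  ((size (simple_base_graph C k V))%:R <= 2 * logb (k.+1%:R) (n%:R) + 2 :> R)%R /\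
  ((size (base_graph C k V))%:R <= 2 * logb (k.+1%:R) (n%:R) + 2 :> R)%R.
Proof.
have kV : 0 < k < #|V|.
  case/andP: hk => k0 kn; rewrite k0 hV.
  (* Subtraction is truncated: [n = 0] would give [k <= 0], against [0 < k]. *)
  by case: n kn {hV} => [|n]; [case: k k0|rewrite subn1].
have [p sp pV] := size_simple_base_graph C kV.
suff h m : m <= size (simple_base_graph C k V) ->
    (m%:R <= 2 * logb k.+1%:R n%:R + 2 :> R)%R.
  by split; apply: h; rewrite ?size_base_graph_le.
move=> /leq_trans/(_ sp); rewrite -(ler_nat R) => /le_trans; apply.
rewrite -addn2 natrD lerD2r -mul2n natrM ler_wpM2l// natr_le_logb//.
  by case/andP: kV.
by rewrite -hV.
Qed.
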